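(* A functionally Hausdorff K-analytic space $X$ is at most countable if and only if $X$ has countable pseudocharacter and every compact subset of $X$ is at most countable.
   Context: A topological space $X$ is functionally Hausdorff if for any distinct points $x,y\in X$ there exists a continuous map $f:X\to[0,1]$ with $f(x)=0$ and $f(y)=1$. A space is Čech-complete if it is Tychonoff and is a $G_\delta$-set in some (equivalently, any) of its compactifications. A topological space is Lindelöf if each of its open covers has a countable subcover. A topological space $X$ is K-analytic if it is a continuous image of a Lindelöf Čech-complete space. The pseudocharacter $\psi(X)$ of a topological space $X$ is the smallest cardinal $\kappa$ such that for any point $x\in X$ the family $\tau_x$ of all open neighborhoods of $x$ contains a subfamily $\mathcal U_x\subset\tau_x$ of cardinality $|\mathcal U_x|\le\kappa$ with $\bigcap\mathcal U_x=\bigcap\tau_x$; $X$ has countable pseudocharacter if $\psi(X)\le\omega$. *)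

(* Defs.v *)
From HB Require Import structures.
From mathcomp Require Import all_boot all_order all_algebra.
From mathcomp Require Import all_classical all_reals all_analysis borel_hierarchy.

Set Implicit Arguments.
Unset Strict Implicit.
Unset Printing Implicit Defensive.

Import Order.TTheory GRing.Theory Num.Theory.
Import numFieldNormedType.Exports.

Local Open Scope classical_set_scope.
Local Open Scope ring_scope.

Definition functionally_hausdorff (R : realType) (T : topologicalType) : Prop :=
  forall x y : T, x <> y ->
  exists f : T -> R,
    [/\ continuous f, range f `<=` `[0, 1], f x = 0 & f y = 1].

(* [completely_regular_space] does not include any separation axiom; its
   separating uniformities amount to separating functions into [0, 1] by
   [uniform_separatorP]. *)
Definition tychonoff_space (T : topologicalType) : Prop :=
  accessible_space T /\ completely_regular_space T.

Definition topological_embedding (S T : topologicalType) (e : S -> T) : Prop :=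
  injective e /\ @open S = @open (initial_topology e).

Definition compactification (S K : topologicalType) (e : S -> K) : Prop :=
  [/\ compact [set: K], hausdorff_space K,
      topological_embedding e & dense (range e)].

Definition cech_complete (T : topologicalType) : Prop :=
  tychonoff_space T /\
  exists (K : topologicalType) (e : T -> K),
    compactification e /\ Gdelta (range e).

Definition lindelof (T : topologicalType) : Prop :=
  forall F : set (set T), F `<=` open -> \bigcup_(U in F) U = [set: T] ->
  exists G : set (set T),
    [/\ G `<=` F, countable G & \bigcup_(U in G) U = [set: T]].

Definition K_analytic (T : topologicalType) : Prop :=
  exists (Y : topologicalType) (f : Y -> T),
    [/\ lindelof Y, cech_complete Y, continuous f & range f = [set: T]].

(* psi(T) <= |k|: a cardinal is represented by a set k of that cardinality, and
   the least cardinal is expressed by the upper bounds it has. *)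
Definition pseudocharacter_le (T : topologicalType) (I : Type) (k : set I) :
    Prop :=
  forall x : T, exists U : set (set T),
    [/\ U `<=` open_nbhs x, (U #<= k)%card &
        \bigcap_(V in U) V = \bigcap_(V in open_nbhs x) V].

Definition countable_pseudocharacter (T : topologicalType) : Prop :=
  pseudocharacter_le T [set: nat].

(* Main.v *)
Require Import Defs.
From mathcomp Require Import all_boot all_order all_algebra.
From mathcomp Require Import all_classical all_reals all_analysis.
From mathcomp Require Import lra.

Local Open Scope classical_set_scope.

Set Implicit Arguments.
Unset Strict Implicit.
Unset Printing Implicit Defensive.

Import Order.TTheory GRing.Theory Num.Theory.
Import numFieldNormedType.Exports.

(** If [X] is countable, its compact subsets are countable, and the points of
    [X] other than [x] can be excluded one at a time by countably many
    neighborhoods of [x], so [X] has countable pseudocharacter.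

    Conversely, let [X] have countable pseudocharacter, let [f : Y -> X] be a
    continuous surjection from a Lindelof space [Y], and let [e] embed [Y] in a
    compact Hausdorff space [K] as the intersection of open sets [O n]. If [X]
    is uncountable, it has an uncountable compact subset, by a Cantor scheme of
    closed subsets of [Y] with uncountable images.

    - Since [Y] is Lindelof, a closed [Z] with [f @` Z] uncountable has a
      condensation point: a point [y0] all of whose neighborhoods meet [Z] in a
      set with uncountable image ([lindelof_condensation]).

    - There is another one with a different image
      ([lindelof_condensation_pair]): as [f y0] is the only common point of
      countably many open sets [V], the image of one of the closed sets
      [Z `\` f @^-1` V] is uncountable, and a condensation point of that set is
      one of [Z] too. This is where the pseudocharacter matters.

    - Separating these two images by a function to the unit interval, and
      shrinking around the two points, splits [Z] into two closed pieces that
      still have uncountable images, which are now disjoint, and whose closures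
      in [K] lie in a prescribed [O n] ([split_uncountable]).

    - In the resulting binary tree of closed sets [D s], let [L] be the set of
      points of [K] that, at every level [n], belong to the closure of one of
      the [2 ^ n] sets of that level. It is compact, and contained in every
      [O n], hence in [Y]. By compactness each branch of the tree has a point of
      [L] in all its sets, and distinct branches give points with distinct
      images; so [f @` L] is compact and has at least as many points as there
      are binary sequences. *)

(** * Binary sequences and trees *)

(** Cantor's diagonal: for an injection [h] to [nat], a sequence whose value at
    [h c] is the negation of [c (h c)] would differ from itself at its own
    code. *)
Lemma cantor_uncountable : ~ countable [set: nat -> bool].
Proof.
move=> /countable_injP[h hinj].
pose b n := `[< exists2 c : nat -> bool, h c = n & ~~ c n >].
have [bb|/negP nb] := boolP (b (h b)).
  move/asboolP: (bb) => [c hc]; rewrite (hinj c b) ?inE //.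
  by rewrite bb.
by apply/nb/asboolP; exists b => //; apply/negP.
Qed.

Lemma injective_countable_setT (S T : Type) (g : S -> T) (A : set T) :
  injective g -> range g `<=` A -> countable A -> countable [set: S].
Proof.
move=> ginj gA /countable_injP[h hinj]; apply/countable_injP; exists (h \o g).
move=> x y _ _ /= hxy.
by apply/ginj/hinj => //; apply/mem_set/gA; [exists x|exists y].
Qed.

Lemma finite_size_seq (n : nat) : finite_set [set s : seq bool | size s = n].
Proof.
apply: (@sub_finite_set _ _ (range (@tval n bool))).
  by move=> s /= /eqP sn; exists (Tuple sn).
by apply: finite_image; exact: finite_finset.
Qed.

(** The last choice comes first, so that the one-step extensions of a node [s]
    of the tree are [true :: s] and [false :: s]. *)
Fixpoint rev_prefix (b : nat -> bool) (n : nat) : seq bool :=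
  if n is m.+1 then b m :: rev_prefix b m else [::].

Lemma size_rev_prefix b n : size (rev_prefix b n) = n.
Proof. by elim: n => //= n ->. Qed.

(** The first index where the sequences differ. *)
Lemma branches_split (b c : nat -> bool) : b <> c ->
  exists n, rev_prefix b n = rev_prefix c n /\ c n = ~~ b n.
Proof.
move=> bc; have /ex_minnP[n bcn nmin] : exists n, b n != c n.
  apply: contrapT => /forallNP bceq; apply/bc/funext => n.
  by have /negP := bceq n; rewrite negbK => /eqP.
exists n; split; last by case: (b n) (c n) bcn => [] [].
have agree m : (m < n)%N -> b m = c m.
  by move=> mn; apply/eqP; apply: contraTT mn => /nmin; rewrite -leqNgt.
elim: n agree {nmin bcn} => //= n IHn agree.
by rewrite agree // IHn // => m mn; apply: agree; exact: ltnW.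
Qed.

(** The tree [D] iterates a splitting procedure. [P] is the invariant that
    allows the next split, [Q n] is what is gained by splitting at level [n],
    and [R] is the relation established between siblings. *)
Lemma cantor_scheme (T : Type) (P : set T -> Prop) (Q : nat -> set T -> Prop)
    (R : set T -> set T -> Prop) (Z : set T) :
  (forall n A, P A -> exists W : bool -> set T,
     (forall b, [/\ P (W b), W b `<=` A & Q n (W b)]) /\
     R (W true) (W false)) ->
  P Z ->
  exists D : seq bool -> set T,
    [/\ forall s, P (D s), forall s b, D (b :: s) `<=` D s,
        forall s b, Q (size s) (D (b :: s)) &
        forall s, R (D (true :: s)) (D (false :: s))].
Proof.
move=> split PZ.
(* A choice function is total: the split of an [A] outside [P] is arbitrary. *)
have /choice[G GP] : forall nA : nat * set T, exists W : bool -> set T,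
    P nA.2 -> (forall b, [/\ P (W b), W b `<=` nA.2 & Q nA.1 (W b)]) /\
    R (W true) (W false).
  move=> [n A]; have [/(split n)[W WP]|nPA] := pselect (P A); first by exists W.
  by exists (fun=> set0) => /nPA.
pose fix D s := if s is b :: t then G (size t, D t) b else Z.
have PD s : P (D s).
  elim: s => //= b s IHs; by have [/(_ b)[]] := GP (size s, D s) IHs.
exists D; split=> // s.
- by move=> b; have [/(_ b)[]] := GP (size s, D s) (PD s).
- by move=> b; have [/(_ b)[]] := GP (size s, D s) (PD s).
- by have [] := GP (size s, D s) (PD s).
Qed.

(** * Compactness and embeddings *)

Lemma nested_closed_compact (K : topologicalType) (C : nat -> set K) :
  compact [set: K] -> (forall n, closed (C n)) -> (forall n, C n !=set0) ->
  (forall n, C n.+1 `<=` C n) -> \bigcap_n C n !=set0.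
Proof.
move=> Kco Ccl Cn0 Cdec.
have Cmono m n : (m <= n)%N -> C n `<=` C m.
  move=> /subnKC <-; elim: (n - m)%N => [|k IHk]; first by rewrite addn0.
  by rewrite addnS; exact: subset_trans (Cdec _) IHk.
have FF : ProperFilter (filter_from [set: nat] C).
  apply: filter_from_proper => //; apply: filter_from_filter.
    by exists 0%N.
  move=> i j _ _; exists (maxn i j) => //.
  by rewrite subsetI; split; apply: Cmono; rewrite ?leq_maxl ?leq_maxr.
have [|p [_ clp]] := Kco _ FF; first by exists 0%N.
exists p => n _; apply: Ccl => U pU.
by have := clp (C n) U; apply => //; exists n.
Qed.

Lemma embedding_nbhs (S T : topologicalType) (e : S -> T) (x : S) (B : set S) :
  topological_embedding e -> nbhs x B ->
  exists V, [/\ open V, V (e x) & e @^-1` V `<=` B].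
Proof.
move=> [_ openE]; rewrite nbhsE => -[U [Uo Ux] UB].
move: Uo; rewrite openE => -[V Vo VU].
by exists V; split=> //; [move: Ux; rewrite -VU|rewrite VU].
Qed.

Lemma embedding_continuous (S T : topologicalType) (e : S -> T) :
  topological_embedding e -> continuous e.
Proof.
move=> [_ openE]; apply/continuousP => V Vo.
by rewrite openE; exists V.
Qed.

Lemma embedding_closed_preimage (S T : topologicalType) (e : S -> T)
    (Z : set S) :
  topological_embedding e -> closed Z -> e @^-1` closure (e @` Z) `<=` Z.
Proof.
move=> emb Zcl y ey; apply: Zcl => B /(embedding_nbhs emb)[V [Vo Vy VB]].
have [_ [[z Zz <-] Vz]] := ey V (open_nbhs_nbhs (conj Vo Vy)).
by exists z; split=> //; exact: VB.
Qed.

Lemma embedding_compact_preimage (S T : topologicalType) (e : S -> T)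
    (L : set T) :
  topological_embedding e -> compact L -> L `<=` range e ->
  compact (e @^-1` L).
Proof.
move=> emb Lco Lrange F FF FL.
have [p [Lp clp]] := Lco (fmap e F) (fmap_proper_filter e FF) FL.
have [y _ eyp] := Lrange p Lp; exists y; split; first by rewrite /= eyp.
move=> A B FA /(embedding_nbhs emb)[V [Vo Vy VB]].
have FA' : fmap e F (e @` A) by apply: (@filterS _ F _ A) FA => z Az; exists z.
have pV : nbhs p V by rewrite -eyp; exact: open_nbhs_nbhs.
have [_ [[z Az <-] Vz]] := clp _ _ FA' pV.
by exists z; split=> //; exact: VB.
Qed.

(** * Separation and pseudocharacter *)

Lemma functionally_hausdorff_closed_nbhs (R : realType) (X : topologicalType)
    (x y : X) :
  functionally_hausdorff R X -> x <> y ->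
  exists A B : set X,
    [/\ closed A, closed B, nbhs x A, nbhs y B & A `&` B = set0].
Proof.
move=> fH /fH[h [hc _ hx hy]].
(* Any two levels [a < b] strictly between 0 and 1 would do here. *)
exists (h @^-1` [set r | r <= 3^-1]%R), (h @^-1` [set r | 2^-1 <= r]%R); split.
- by apply: closed_comp => [? _|]; [exact: hc|exact: closed_le].
- by apply: closed_comp => [? _|]; [exact: hc|exact: closed_ge].
- apply: hc; rewrite hx.
  apply: filterS (open_nbhs_nbhs (conj (@open_lt _ 3^-1%R) _)).
    by move=> r /ltW.
  by rewrite /= invr_gt0 ltr0n.
- apply: hc; rewrite hy.
  apply: filterS (open_nbhs_nbhs (conj (@open_gt _ 2^-1%R) _)).
    by move=> r /ltW.
  by rewrite /= invf_lt1 ?ltr1n ?ltr0n.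
- by apply/seteqP; split=> // z /= []; lra.
Qed.

Lemma functionally_hausdorff_open (R : realType) (X : topologicalType)
    (x y : X) :
  functionally_hausdorff R X -> x <> y ->
  exists2 U : set X, open_nbhs x U & ~ U y.
Proof.
move=> fH /(functionally_hausdorff_closed_nbhs fH)[A [B [_ _ Ax By AB0]]].
move: Ax; rewrite nbhsE => -[U Ux UA]; exists U => // Uy.
suff : set0 y by [].
by rewrite -AB0; split; [exact: UA|exact: nbhs_singleton].
Qed.

(** For each point [y] other than [x] pick a neighborhood of [x] missing [y]. *)
Lemma countable_countable_pseudocharacter (R : realType) (X : topologicalType) :
  functionally_hausdorff R X -> countable [set: X] ->
  countable_pseudocharacter X.
Proof.
move=> fH Xc x.
have /choice[U UP] : forall y, exists U, open_nbhs x U /\ (x <> y -> ~ U y).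
  move=> y; have [->|xy] := pselect (x = y).
    by exists setT; split=> //; split=> //; exact: openT.
  by have [U Ux Uy] := functionally_hausdorff_open fH xy; exists U.
exists (range U); split.
- by move=> _ [y _ <-]; have [] := UP y.
- by apply: card_le_trans Xc; exact: card_image_le.
- apply/seteqP; split=> z capz.
    have -> : z = x; last by move=> V [].
    apply: contrapT => /nesym xz; have [_] := UP z; apply=> //.
    by apply: capz; exists z.
  by move=> _ [y _ <-]; apply: capz; have [] := UP y.
Qed.

(** * Condensation points *)

(** Otherwise the open sets meeting [Z] in a set with countable image cover [Y]:
    those around the points of [Z] by assumption, and the complement of [Z]
    because it does not meet [Z]. A countable subcover makes [f @` Z]
    countable. *)
Lemma lindelof_condensation (Y : topologicalType) (X : Type) (f : Y -> X)
    (Z : set Y) :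
  lindelof Y -> closed Z -> ~ countable (f @` Z) ->
  exists2 y, Z y & forall U, nbhs y U -> ~ countable (f @` (Z `&` U)).
Proof.
move=> Yl Zcl; apply: contra_notP => noy.
have [||G [GF Gc Gcover]] := Yl [set U | open U /\ countable (f @` (Z `&` U))].
- by move=> U [].
- apply/seteqP; split=> // y _; have [Zy|nZy] := pselect (Z y); last first.
    exists (~` Z) => //; split; first exact: closed_openC.
    by rewrite setICr image_set0; exact: countable0.
  apply: contrapT => ny; apply: noy; exists y => // V.
  rewrite nbhsE => -[U [Uo Uy] UV] cV; apply: ny; exists U => //; split=> //.
  apply: sub_countable cV; apply: subset_card_le; apply: image_subset.
  exact: setIS.
rewrite -(setIT Z) -Gcover setI_bigcupr image_bigcup.
by apply: bigcup_countable => // U /GF[].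
Qed.

(** In a functionally Hausdorff space the neighborhoods of [x] have no other
    common point than [x], so a witness of countable pseudocharacter at [x]
    excludes all the others. *)
Lemma countable_pseudocharacter_separation (R : realType) (X : topologicalType)
    (x : X) :
  functionally_hausdorff R X -> countable_pseudocharacter X ->
  exists U : set (set X), [/\ countable U, forall V, U V -> open V /\ V x &
    forall z, z <> x -> exists2 V, U V & ~ V z].
Proof.
move=> fH /(_ x)[U [Unbhs Uc Ucap]]; exists U; split=> //.
move=> z /nesym zx; have [W Wx Wz] := functionally_hausdorff_open fH zx.
apply: contrapT => /forall2NP Uz; apply: Wz.
suff : (\bigcap_(V in U) V) z by rewrite Ucap; exact.
by move=> V UV; have [/(_ UV)//|/contrapT] := Uz V.
Qed.

(** Away from [f y0], the set [f @` Z] is the union of the images of the sets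
    [Z `\` f @^-1` V], for the countably many open [V] that determine [f y0]; so
    one of these closed sets has an uncountable image, and a condensation point
    whose image avoids the corresponding [V]. *)
Lemma lindelof_condensation_pair (R : realType) (Y X : topologicalType)
    (f : Y -> X) (Z : set Y) :
  functionally_hausdorff R X -> countable_pseudocharacter X ->
  lindelof Y -> continuous f -> closed Z -> ~ countable (f @` Z) ->
  exists y : bool -> Y, f (y true) <> f (y false) /\
    forall b U, nbhs (y b) U -> ~ countable (f @` (Z `&` U)).
Proof.
move=> fH psi Yl fc Zcl Zunc.
have [y0 Zy0 y0cond] := lindelof_condensation Yl Zcl Zunc.
have [G [Gc Gx Gsep]] := countable_pseudocharacter_separation (f y0) fH psi.
have [V GV Vunc] : exists2 V, G V & ~ countable (f @` (Z `&` f @^-1` (~` V))).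
  apply: contrapT => /forall2NP noV; apply: Zunc.
  apply: (@sub_countable _ _ _
    ([set f y0] `|` \bigcup_(V in G) f @` (Z `&` f @^-1` (~` V)))).
    apply: subset_card_le => _ [z Zz <-].
    have [->|/Gsep[V GV Vfz]] := pselect (f z = f y0); first by left.
    by right; exists V => //; exists z.
  rewrite -bigcup2E; apply: bigcup_countable => // -[|[|k]] _ /=.
  - exact: countable1.
  - by apply: bigcup_countable => // V GV; have [|/contrapT] := noV V.
  - exact: countable0.
have [Vo Vy0] := Gx V GV.
have [|y1 [Zy1 Vy1] y1cond] := lindelof_condensation Yl _ Vunc.
  by apply: closedI => //; apply: closed_comp => [? _|];
    [exact: fc|exact: open_closedC].
exists (fun b => if b then y1 else y0); split.
  by move=> f10; apply: Vy1; rewrite f10.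
move=> [] U yU //; last exact: y0cond.
(* A condensation point of a subset of [Z] is one of [Z]. *)
apply: contra_not (y1cond U yU); apply: sub_countable; apply: subset_card_le.
by apply: image_subset => z [[]].
Qed.

(** Each piece is the part of [Z] near one of two condensation points: near
    in [X], inside one of two disjoint closed neighborhoods of their images, and
    near in [K], inside a neighborhood whose closure lies in [O]. *)
Lemma split_uncountable (R : realType) (Y X K : topologicalType)
    (f : Y -> X) (e : Y -> K) (O : set K) (Z : set Y) :
  functionally_hausdorff R X -> countable_pseudocharacter X ->
  lindelof Y -> continuous f ->
  topological_embedding e -> compact [set: K] -> hausdorff_space K ->
  open O -> range e `<=` O ->
  closed Z -> ~ countable (f @` Z) ->
  exists W : bool -> set Y,
    (forall b, [/\ closed (W b) /\ ~ countable (f @` W b), W b `<=` Z &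
                   closure (e @` W b) `<=` O]) /\
    f @` W true `&` f @` W false = set0.
Proof.
move=> fH psi Yl fc emb Kco KH Oo eO Zcl Zunc.
have [y [fy ycond]] := lindelof_condensation_pair fH psi Yl fc Zcl Zunc.
have [A [B [Acl Bcl Ay By AB0]]] := functionally_hausdorff_closed_nbhs fH fy.
have /choice[V VP] : forall b, exists V, nbhs (e (y b)) V /\ closure V `<=` O.
  move=> b; have Oy : nbhs (e (y b)) O.
    by apply: open_nbhs_nbhs; split=> //; apply: eO; exists (y b).
  have [V Vy VO] := compact_regular KH Kco filterT Oy.
  by exists V.
pose C b := if b then A else B.
have Cy b : nbhs (f (y b)) (C b) by case: b.
have Ccl b : closed (C b) by case: b.
exists (fun b => Z `&` (f @^-1` C b `&` e @^-1` closure (V b))).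
split; last first.
  apply/seteqP; split=> // _ [[z [_ [Az _]] <-] [z' [_ [Bz' _]] zz']].
  by rewrite -AB0; split=> //=; rewrite -zz'.
move=> b; have [Vb VO] := VP b; split; [split| |].
- apply: closedI => //; apply: closedI.
    by apply: closed_comp => [? _|]; [exact: fc|exact: Ccl].
  apply: closed_comp => [? _|]; last exact: closed_closure.
  exact: embedding_continuous.
- apply: ycond; apply: filterI; first exact: (fc (y b) (C b) (Cy b)).
  apply: (embedding_continuous emb); apply: filterS Vb; exact: subset_closure.
- by move=> z [].
- apply: subset_trans VO; apply: subset_trans (@closed_closure _ (V b)).
  by apply: closureS => _ [z [_ [_ Vz]] <-].
Qed.

(** * The uncountable compact set *)

Lemma uncountable_compact (R : realType) (X : topologicalType) :
  functionally_hausdorff R X -> K_analytic X -> countable_pseudocharacter X ->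
  ~ countable [set: X] -> exists2 A : set X, compact A & ~ countable A.
Proof.
move=> fH [Y [f [Yl [_ [K [e [[Kco KH emb _] [ O Oo eO]]]]] fc fT]]] psi Xunc.
have eOn n : range e `<=` O n by rewrite eO; exact: bigcap_inf.
have [|D [DP Ddec DO Ddisj]] := @cantor_scheme Y
    (fun A => closed A /\ ~ countable (f @` A))
    (fun n A => closure (e @` A) `<=` O n)
    (fun A B => f @` A `&` f @` B = set0) setT
    (fun n A AP =>
       split_uncountable fH psi Yl fc emb Kco KH (Oo n) (@eOn n) AP.1 AP.2).
  by split; [exact: closedT|rewrite fT].
(* Each level of the tree is finite, so [L] is closed in [K]. *)
pose L := \bigcap_n \bigcup_(s in [set s | size s = n]) closure (e @` D s).
have Lcl : closed L.
  apply: closed_bigI => n _; apply: closed_bigcup; first exact: finite_size_seq.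
  by move=> s _; exact: closed_closure.
have Lrange : L `<=` range e.
  (* The sets of level [n.+1] are those whose closures lie in [O n]. *)
  rewrite eO => p Lp n _; have [[//|b s] /= [sn]] := Lp n.+1 I.
  by move=> /(DO s b); rewrite sn.
exists (f @` (e @^-1` L)).
  apply: continuous_compact; first exact/continuous_subspaceT.
  apply: embedding_compact_preimage => //.
  exact: subclosed_compact Lcl Kco _.
have /choice[y yD] : forall b : nat -> bool,
    exists y, forall n, D (rev_prefix b n) y.
  move=> b; have [|||p pD] := nested_closed_compact
      (C := fun n => closure (e @` D (rev_prefix b n))) Kco.
  - by move=> n; exact: closed_closure.
  - move=> n; have [_ Dunc] := DP (rev_prefix b n).
    apply: contrapT => /nonemptyPn De; apply: Dunc.
    suff -> : D (rev_prefix b n) = set0.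
      by rewrite image_set0; exact: countable0.
    apply: contrapT => /eqP/set0P[z Dz]; suff : set0 (e z) by [].
    by rewrite -De; apply: subset_closure; exists z.
  - by move=> n; apply: closureS; apply: image_subset; exact: Ddec.
  have [|z _ ezp] := Lrange p.
    by move=> n _; exists (rev_prefix b n); [exact: size_rev_prefix|exact: pD].
  exists z => n; apply: (embedding_closed_preimage emb).
    by have [] := DP (rev_prefix b n).
  by rewrite /= ezp; exact: pD.
move=> /(injective_countable_setT (g := f \o y)) cantor.
apply/cantor_uncountable/cantor; last first.
  move=> _ [b _ <-]; exists (y b) => // n _; exists (rev_prefix b n).
    exact: size_rev_prefix.
  by apply: subset_closure; exists (y b).
move=> b c /= ybc; apply: contrapT => /branches_split[n [pre cb]].
have := yD b n.+1; have := yD c n.+1; rewrite /= -pre cb => yc yb.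
suff : set0 (f (y b)) by [].
rewrite -(Ddisj (rev_prefix b n)).
by case: (b n) yb yc => /= yb yc; split; by [exists (y b)|exists (y c)].
Qed.

Theorem corollary2 (R : realType) (X : topologicalType)
    (hX : functionally_hausdorff R X) (kX : K_analytic X) :
  countable [set: X] <->
  countable_pseudocharacter X /\ (forall A : set X, compact A -> countable A).
Proof.
split=> [Xc|[psi Aco]]; last first.
  apply: contrapT => /(uncountable_compact hX kX psi)[A /Aco]; exact.
split; first exact: countable_countable_pseudocharacter hX Xc.
by move=> A _; apply: sub_countable Xc; exact: subset_card_le.
Qed.
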